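(* Let $\kappa_2$ be a regular cardinal with $\kappa_2>\aleph_1$ and assume $\mathbf{MA}_{\aleph_1}$. Then there is no $(\aleph_1,\kappa_2)$-peculiar cut in ${}^\omega\omega$.
   Context: $\mathbf{MA}_{\aleph_1}$: for every ccc forcing notion and every family of $\aleph_1$ dense subsets there is a directed subset meeting all of them. For $f,g\in{}^\omega\omega$: $f\le^*g$ iff $f(n)\le g(n)$ for all but finitely many $n$; $f<^*g$ iff $f(n)<g(n)$ for all but finitely many $n$. For infinite regular cardinals $\kappa_1,\kappa_2$, a $(\kappa_1,\kappa_2)$-peculiar cut in ${}^\omega\omega$ is a pair $(\langle f_i:i<\kappa_1\rangle,\langle f^\alpha:\alpha<\kappa_2\rangle)$ of sequences in ${}^\omega\omega$ such that: ($\alpha$) $f_j<^*f_i$ for $i<j<\kappa_1$; ($\beta$) $f^\alpha<^*f^\beta$ for $\alpha<\beta<\kappa_2$; ($\gamma$) $f^\alpha<^*f_i$ for all $i<\kappa_1$, $\alpha<\kappa_2$; ($\delta$) if $f\in{}^\omega\omega$ and $f\le^*f_i$ for all $i<\kappa_1$, then $f\le^*f^\alpha$ for some $\alpha<\kappa_2$; ($\varepsilon$) if $f\in{}^\omega\omega$ and $f^\alpha\le^*f$ for all $\alpha<\kappa_2$, then $f_i\le^*f$ for some $i<\kappa_1$. *)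

(* Defs.v *)
From Stdlib Require Import Arith.

Definition injective {X Y : Type} (f : X -> Y) : Prop :=
  forall x y, f x = f y -> x = y.

Definition countable (X : Type) : Prop :=
  exists f : X -> nat, injective f.

Definition strict_well_order {I : Type} (lt : I -> I -> Prop) : Prop :=
  well_founded lt /\
  (forall x y z, lt x y -> lt y z -> lt x z) /\
  (forall x y, lt x y \/ x = y \/ lt y x).

Definition is_aleph1 (I : Type) (lt : I -> I -> Prop) : Prop :=
  strict_well_order lt /\
  ~ countable I /\
  (forall x : I, countable {y : I | lt y x}).

(** (K, lt) is (the ordinal of) an infinite regular cardinal: an infinite
    well-order which is an initial ordinal (K does not inject into any proper
    initial segment) and every cofinal subset has the full cardinality of K. *)
Definition is_regular_cardinal (K : Type) (lt : K -> K -> Prop) : Prop :=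
  strict_well_order lt /\
  (exists g : nat -> K, injective g) /\
  (forall x : K, ~ exists f : K -> {y : K | lt y x}, injective f) /\
  (forall A : K -> Prop,
      (forall x, exists y, A y /\ (x = y \/ lt x y)) ->
      exists f : K -> {y : K | A y}, injective f).

Definition above_aleph1 (K : Type) : Prop :=
  forall (W : Type) (ltW : W -> W -> Prop), is_aleph1 W ltW ->
    ~ exists f : K -> W, injective f.

(** Forcing notions: p <= q means p is stronger than q. *)
Section Forcing.
Context {P : Type} (le : P -> P -> Prop).

Definition compatible (p q : P) : Prop := exists r, le r p /\ le r q.

Definition antichain (A : P -> Prop) : Prop :=
  forall p q, A p -> A q -> p <> q -> ~ compatible p q.

Definition ccc : Prop :=
  forall A : P -> Prop, antichain A -> countable {p : P | A p}.

Definition dense (D : P -> Prop) : Prop :=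
  forall p, exists q, le q p /\ D q.

Definition directed (G : P -> Prop) : Prop :=
  forall p q, G p -> G q -> exists r, G r /\ le r p /\ le r q.
End Forcing.

Definition MA_aleph1 : Prop :=
  forall (P : Type) (le : P -> P -> Prop),
    inhabited P ->
    (forall p, le p p) ->
    (forall p q r, le p q -> le q r -> le p r) ->
    ccc le ->
    forall (I : Type) (ltI : I -> I -> Prop), is_aleph1 I ltI ->
    forall D : I -> P -> Prop, (forall i, dense le (D i)) ->
    exists G : P -> Prop, directed le G /\ (forall i, exists p, G p /\ D i p).

Definition baire := nat -> nat.

Definition le_star (f g : baire) : Prop :=
  exists N, forall n, N <= n -> f n <= g n.

Definition lt_star (f g : baire) : Prop :=
  exists N, forall n, N <= n -> f n < g n.

Definition peculiar_cut {I K : Type} (ltI : I -> I -> Prop) (ltK : K -> K -> Prop)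
  (flo : I -> baire) (fup : K -> baire) : Prop :=
  (forall i j, ltI i j -> lt_star (flo j) (flo i)) /\
  (forall a b, ltK a b -> lt_star (fup a) (fup b)) /\
  (forall i a, lt_star (fup a) (flo i)) /\
  (forall f, (forall i, le_star f (flo i)) -> exists a, le_star f (fup a)) /\
  (forall f, (forall a, le_star (fup a) f) -> exists i, le_star (flo i) f).

(* Main.v *)
From Stdlib Require Import Arith Lia List Classical Cantor IndefiniteDescription.
Require Import Defs.

(** By MA there are an uncountable [U] and functions [g i], [i] in [U], such that
    [g i <= flo i] everywhere, [g i <=* flo j] for all [j], and any two distinct
    [i], [j] in [U] satisfy [g i k > flo j k] or [g j k > flo i k] for some [k].
    No [h] can satisfy [g i <=* h <=* flo i] for all [i] in [U]: uncountably many
    [i] would share the same threshold [N] and the same restriction of [flo i] to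
    [N], and two of these violate the last property.  But a peculiar cut provides
    such an [h]: each [g i] lies below some [fup a], and as the regular cardinal
    [K] exceeds [aleph_1], one [fup a] lies above all of the [g i].

    The forcing consists of finite approximations of the [g i].  It is ccc because
    a condition can be amalgamated with any condition that agrees with it on the
    common support and has the rest of its support higher up; in an uncountable
    family, a closing-off argument below a countable ordinal finds two such. *)

(** * Countable types and finite lists *)

Lemma countable_of_injective {X Y : Type} (f : X -> Y) :
  injective f -> countable Y -> countable X.
Proof.
  intros Hf [c Hc]; exists (fun x => c (f x)).
  intros x y H; apply Hf, Hc, H.
Qed.

Lemma countable_nat : countable nat.
Proof. exists (fun n => n); intros x y H; exact H. Qed.

Lemma cantor_inj (p q : nat * nat) : to_nat p = to_nat q -> p = q.
Proof. intros H; rewrite <- (cancel_of_to p), <- (cancel_of_to q), H; reflexivity. Qed.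

Lemma countable_prod {X Y : Type} :
  countable X -> countable Y -> countable (X * Y).
Proof.
  intros [f Hf] [g Hg]; exists (fun p => to_nat (f (fst p), g (snd p))).
  intros [x y] [x' y'] H; apply cantor_inj in H; cbn in H; injection H as H1 H2.
  apply Hf in H1; apply Hg in H2; congruence.
Qed.

Lemma countable_list {X : Type} : countable X -> countable (list X).
Proof.
  intros [f Hf].
  exists (fix code l := match l with
                        | nil => 0
                        | x :: l => S (to_nat (f x, code l))
                        end).
  intros l; induction l as [|x l IH]; intros [|y m] H; try discriminate H.
  - reflexivity.
  - apply Nat.succ_inj, cantor_inj in H; injection H as H1 H2.
    apply Hf in H1; apply IH in H2; congruence.
Qed.

(** A classical filter, for predicates that need not be decidable. *)
Lemma sublist_exists {X : Type} (Q : X -> Prop) (l : list X) :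
  exists l', forall x, In x l' <-> In x l /\ Q x.
Proof.
  induction l as [|a l [l' IH]].
  - exists nil; cbn; tauto.
  - destruct (classic (Q a)) as [Ha|Ha].
    + exists (a :: l'); intros x; cbn; rewrite IH; intuition congruence.
    + exists l'; intros x; cbn; rewrite IH; intuition congruence.
Qed.

Lemma eventually_forall_list {X : Type} (Q : X -> nat -> Prop) (l : list X) :
  (forall x, In x l -> exists N, forall k, N <= k -> Q x k) ->
  exists N, forall x, In x l -> forall k, N <= k -> Q x k.
Proof.
  induction l as [|a l IH]; intros H.
  - exists 0; intros x [].
  - destruct IH as [N HN]; [intros x Hx; apply H; right; exact Hx|].
    destruct (H a (or_introl eq_refl)) as [M HM].
    exists (max N M); intros x [<-|Hx] k Hk.
    + apply HM; lia.
    + apply HN; [exact Hx|lia].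
Qed.

Lemma separate_lists (la lb : list nat) :
  (forall a b, In a la -> In b lb -> b < a) ->
  exists M, (forall a, In a la -> M <= a) /\ (forall b, In b lb -> b < M).
Proof.
  intros H; induction lb as [|b lb IH].
  - exists 0; split; [intros; lia|intros b []].
  - destruct IH as [M [HM1 HM2]]; [intros; apply H; [|right]; assumption|].
    exists (max (S b) M); split.
    + intros a Ha; specialize (HM1 a Ha); specialize (H a b Ha (or_introl eq_refl)); lia.
    + intros c [<-|Hc]; [lia|specialize (HM2 c Hc); lia].
Qed.

(** * Bounds in [aleph_1] and in regular cardinals *)

Lemma strict_well_order_irrefl {I : Type} (lt : I -> I -> Prop) :
  strict_well_order lt -> forall x, ~ lt x x.
Proof.
  intros [Hwf _] x; induction (Hwf x) as [x _ IH]; intros Hx; exact (IH x Hx Hx).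
Qed.

(** If no [b] bounded [f], every element of [I] would equal some [f x] or lie below one, so [I]
    would be a countable union of countable sets. *)
Lemma aleph1_bounded {I : Type} (lt : I -> I -> Prop) : is_aleph1 I lt ->
  forall (X : Type) (f : X -> I), countable X -> exists b, forall x, lt (f x) b.
Proof.
  intros [[_ [_ Htot]] [Hunc Hseg]] X f [cX HcX].
  apply NNPP; intros Hb; apply Hunc.
  (* [c i] numbers the predecessors of [i]; as a relation, its type does not depend on [i]. *)
  destruct (functional_choice
    (fun i (c : nat -> I -> Prop) =>
       (forall m y z, c m y -> c m z -> y = z) /\ (forall y, lt y i -> exists m, c m y)))
    as [c Hc].
  { intros i; destruct (Hseg i) as [c Hc].
    exists (fun m y => exists H, m = c (exist _ y H)); split.
    - intros m y z [Hy ->] [Hz E]; apply Hc in E; injection E as E; exact E.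
    - intros y H; exists (c (exist _ y H)), H; reflexivity. }
  (* Second component 0 codes [f x] itself, [S k] its predecessor with number [k]. *)
  destruct (functional_choice (fun b m => exists x,
      (m = to_nat (cX x, 0) /\ b = f x) \/
      (exists k, c (f x) k b /\ m = to_nat (cX x, S k)))) as [code Hcode].
  { intros b.
    assert (Hx : exists x, ~ lt (f x) b).
    { apply NNPP; intros H; apply Hb; exists b; intros x; apply NNPP; intros Hx.
      apply H; exists x; exact Hx. }
    destruct Hx as [x Hx]; destruct (Htot b (f x)) as [H|[H|H]].
    - destruct (proj2 (Hc (f x)) b H) as [k Hk].
      exists (to_nat (cX x, S k)), x; right; exists k; auto.
    - exists (to_nat (cX x, 0)), x; left; auto.
    - contradiction. }
  exists code; intros b b' E.
  destruct (Hcode b) as [x [[E1 Hb1]|[k [Hk1 E1]]]];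
  destruct (Hcode b') as [x' [[E2 Hb2]|[k' [Hk2 E2]]]];
  rewrite E1, E2 in E; apply cantor_inj in E; try discriminate E.
  - injection E as E; apply HcX in E; congruence.
  - injection E as E E'; apply HcX in E; subst x' k'.
    exact (proj1 (Hc (f x)) _ _ _ Hk1 Hk2).
Qed.

(** An unbounded range of [a] would be cofinal, so [K] would inject into it and, by choosing
    preimages, into [I]. *)
Lemma regular_bounded {K I : Type} (ltK : K -> K -> Prop) (ltI : I -> I -> Prop) :
  is_regular_cardinal K ltK -> above_aleph1 K -> is_aleph1 I ltI ->
  forall a : I -> K, exists b, forall i, ltK (a i) b.
Proof.
  intros [[_ [_ Htot]] [_ [_ Hcof]]] Habove HI a.
  apply NNPP; intros Hb.
  destruct (Hcof (fun y => exists i, y = a i)) as [F HF].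
  { intros x; apply NNPP; intros Hx; apply Hb; exists x; intros i.
    destruct (Htot (a i) x) as [H|[H|H]]; [exact H| |];
    exfalso; apply Hx; exists (a i); split; eauto. }
  apply (Habove I ltI HI).
  destruct (functional_choice (fun x i => proj1_sig (F x) = a i)) as [h Hh].
  { intros x; exact (proj2_sig (F x)). }
  exists h; intros x y E; apply HF.
  assert (Exy : proj1_sig (F x) = proj1_sig (F y)) by congruence.
  destruct (F x) as [u p], (F y) as [v q]; cbn in Exy; subst v.
  f_equal; apply proof_irrelevance.
Qed.

(** * The forcing of finite approximations *)

Section Forcing.
Context {I : Type} (flo : I -> baire).

(** [(n, l)] approximates [g i] on [{0, ..., n-1}] for the finitely many [i]
    occurring in the association list [l].  An entry [s] of [l] may have any
    length: the values [nth k s 0] with [k >= n] are ignored. *)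
Definition precond : Type := nat * list (I * list nat).

(** Separation must be witnessed below the height, where values are final, so that it passes to the
    generic functions. *)
Definition wf (p : precond) : Prop :=
  (forall i s t, In (i, s) (snd p) -> In (i, t) (snd p) -> s = t) /\
  (forall i s, In (i, s) (snd p) -> forall k, k < fst p -> nth k s 0 <= flo i k) /\
  (forall i j s t, In (i, s) (snd p) -> In (j, t) (snd p) -> i <> j ->
     exists k, k < fst p /\ (flo j k < nth k s 0 \/ flo i k < nth k t 0)).

(** The last clause is a promise: once [i] and [j] are both in the support, further values for [i]
    stay at most [flo j]. It yields [g i <=* flo j]. *)
Definition pre_le (p q : precond) : Prop :=
  fst q <= fst p /\
  forall i s, In (i, s) (snd q) ->
    exists s', In (i, s') (snd p) /\
      (forall k, k < fst q -> nth k s' 0 = nth k s 0) /\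
      (forall k, fst q <= k -> k < fst p ->
         forall j t, In (j, t) (snd q) -> nth k s' 0 <= flo j k).

Definition cond : Type := {p : precond | wf p}.

Definition cond_le (p q : cond) : Prop := pre_le (proj1_sig p) (proj1_sig q).

Lemma cond_eq (p q : cond) : proj1_sig p = proj1_sig q -> p = q.
Proof.
  destruct p as [p Hp], q as [q Hq]; cbn; intros <-; f_equal; apply proof_irrelevance.
Qed.

Lemma cond_le_refl (p : cond) : cond_le p p.
Proof.
  split; [lia|]; intros i s H; exists s; repeat split; auto.
  intros; lia.
Qed.

Lemma cond_le_trans (p q r : cond) : cond_le p q -> cond_le q r -> cond_le p r.
Proof.
  intros [Hpq1 Hpq2] [Hqr1 Hqr2]; split; [lia|]; intros i s H.
  destruct (Hqr2 i s H) as [s' [Hs' [Hs'1 Hs'2]]].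
  destruct (Hpq2 i s' Hs') as [s'' [Hs'' [Hs''1 Hs''2]]].
  exists s''; split; [exact Hs''|]; split.
  - intros k Hk; rewrite Hs''1 by lia; auto.
  - intros k Hk1 Hk2 j t Hj.
    destruct (le_lt_dec (fst (proj1_sig q)) k) as [Hk|Hk].
    + destruct (Hqr2 j t Hj) as [t' [Ht' _]]; eauto.
    + rewrite Hs''1 by exact Hk; eauto.
Qed.

(** New levels are filled with 0, which meets every bound; only level [N] carries a chosen value
    [v]. *)
Definition extend (n N v : nat) (s : list nat) : list nat :=
  map (fun k => if k <? n then nth k s 0 else if k =? N then v else 0) (seq 0 (S N)).

Lemma nth_extend n N v s k : k <= N ->
  nth k (extend n N v s) 0 =
  if k <? n then nth k s 0 else if k =? N then v else 0.
Proof.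
  intros H; unfold extend.
  rewrite (nth_indep _ 0 ((fun k => if k <? n then nth k s 0 else if k =? N then v else 0) 0))
    by (rewrite length_map, length_seq; lia).
  rewrite (map_nth (fun k => if k <? n then nth k s 0 else if k =? N then v else 0)).
  rewrite seq_nth by lia; reflexivity.
Qed.

Lemma nth_extend_lt n N v s k : k < n -> n <= N -> nth k (extend n N v s) 0 = nth k s 0.
Proof.
  intros H1 H2; rewrite nth_extend by lia.
  apply Nat.ltb_lt in H1; rewrite H1; reflexivity.
Qed.

Lemma nth_extend_last n N v s : n <= N -> nth N (extend n N v s) 0 = v.
Proof.
  intros H; rewrite nth_extend by lia.
  apply Nat.ltb_ge in H; rewrite H, Nat.eqb_refl; reflexivity.
Qed.

Lemma nth_extend_le n N v s k B : n <= k -> k < S N -> (k = N -> v <= B) ->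
  nth k (extend n N v s) 0 <= B.
Proof.
  intros H1 H2 H3; rewrite nth_extend by lia.
  apply Nat.ltb_ge in H1; rewrite H1.
  destruct (Nat.eqb_spec k N); [auto|lia].
Qed.

(** * Amalgamation of conditions *)

Context (lt : I -> I -> Prop) (Haleph : is_aleph1 I lt)
  (Hdec : forall i j, lt i j -> lt_star (flo j) (flo i)).

(* A large [N] has [flo j N < flo i N] for all [i] in the support of [p] and all
   new [j] of [q], so giving the indices [i] that belong only to [p] a value in
   between at [N] separates them from the new [j]. *)
Lemma amalgamation (p q : cond) :
  fst (proj1_sig p) = fst (proj1_sig q) ->
  (forall j t, In (j, t) (snd (proj1_sig q)) ->
     In (j, t) (snd (proj1_sig p)) \/
     forall i s, In (i, s) (snd (proj1_sig p)) -> lt i j) ->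
  compatible cond_le p q.
Proof.
  destruct p as [[n lp] Hp], q as [[n' lq] Hq]; cbn; intros <- Hroot.
  assert (Hirr := strict_well_order_irrefl lt (proj1 Haleph)).
  destruct (sublist_exists
    (fun jt => forall i s, In (i, s) lp -> lt i (fst jt)) lq) as [lnew Hnew].
  destruct (sublist_exists (fun is => forall t, ~ In (fst is, t) lq) lp) as [lown Hown].
  destruct (eventually_forall_list
    (fun is k => forall jt, In jt lnew -> flo (fst jt) k < flo (fst is) k) lp)
    as [N0 HN0].
  { intros [i s] Hi.
    destruct (eventually_forall_list (fun jt k => flo (fst jt) k < flo i k) lnew)
      as [N HN].
    - intros [j t] Hj; apply Hnew in Hj; apply Hdec; apply (proj2 Hj i s Hi).
    - exists N; intros k Hk jt Hjt; apply HN; assumption. }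
  (* [N >= n] makes this a fresh level, above all values already fixed. *)
  set (N := max n N0).
  destruct (separate_lists (map (fun is => flo (fst is) N) lp)
                           (map (fun jt => flo (fst jt) N) lnew)) as [M [HM1 HM2]].
  { intros a b Ha Hb; apply in_map_iff in Ha as [is [<- Ha]].
    apply in_map_iff in Hb as [jt [<- Hb]].
    apply HN0; [exact Ha|lia|exact Hb]. }
  assert (HMp : forall i s, In (i, s) lp -> M <= flo i N).
  { intros i s Hi; apply HM1; apply in_map_iff; exists (i, s); auto. }
  assert (HMq : forall j t, In (j, t) lnew -> flo j N < M).
  { intros j t Hj; apply HM2; apply in_map_iff; exists (j, t); auto. }
  assert (HnN : n <= N) by lia.
  clearbody N; clear HM1 HM2 HN0.
  destruct Hp as [Hp1 [Hp2 Hp3]]; cbn in Hp1, Hp2, Hp3.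
  destruct Hq as [Hq1 [Hq2 Hq3]]; cbn in Hq1, Hq2, Hq3.
  (* Indices of [q] take only zeros on new levels; those only in [p] take [M] at [N], which keeps
     the promises of [p] since [M <= flo j N] for all [j] in its support. *)
  set (lr := map (fun jt => (fst jt, extend n N 0 (snd jt))) lq ++
             map (fun is => (fst is, extend n N M (snd is))) lown).
  assert (Hlr : forall i s, In (i, s) lr <->
    (exists t, In (i, t) lq /\ s = extend n N 0 t) \/
    (exists t, In (i, t) lp /\ (forall t', ~ In (i, t') lq) /\ s = extend n N M t)).
  { intros i s; unfold lr; rewrite in_app_iff, !in_map_iff; split.
    - intros [[[j t] [E H]]|[[j t] [E H]]]; cbn in E; injection E as <- <-.
      + left; exists t; auto.
      + apply Hown in H; right; exists t; intuition.
    - intros [[t [H ->]]|[t [H1 [H2 ->]]]].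
      + left; exists (i, t); auto.
      + right; exists (i, t); split; [reflexivity|]; apply Hown; auto. }
  clearbody lr.
  (* Either [j] has the same entry in [p], and [p] separates the pair, or [j] is new and [M] exceeds
     [flo j N]. *)
  assert (Hmix : forall i j s t, In (i, s) lp -> (forall t', ~ In (i, t') lq) ->
    In (j, t) lq -> exists k, k < S N /\
      (flo j k < nth k (extend n N M s) 0 \/ flo i k < nth k (extend n N 0 t) 0)).
  { intros i j s t Hi Hiq Hj; destruct (Hroot j t Hj) as [Hjp|Hjp].
    - destruct (Hp3 i j s t Hi Hjp) as [k [Hk Hk']].
      { intros ->; exact (Hiq _ Hj). }
      exists k; rewrite !nth_extend_lt by lia; split; [lia|exact Hk'].
    - exists N; split; [lia|]; left; rewrite nth_extend_last by lia.
      apply (HMq j t); apply Hnew; auto. }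
  assert (Hr : wf (S N, lr)).
  { split; [|split]; cbn.
    - intros i s s' H H'; apply Hlr in H, H'.
      destruct H as [[t [H ->]]|[t [H1 [H2 ->]]]];
      destruct H' as [[t' [H' ->]]|[t' [H1' [H2' ->]]]].
      + f_equal; eauto.
      + exfalso; eapply H2'; eauto.
      + exfalso; eapply H2; eauto.
      + f_equal; eauto.
    - intros i s H k Hk; apply Hlr in H.
      destruct (le_lt_dec n k) as [Hnk|Hnk];
      destruct H as [[t [H ->]]|[t [H1 [H2 ->]]]].
      + apply nth_extend_le; lia.
      + apply nth_extend_le; [lia|lia|intros ->; eauto].
      + rewrite nth_extend_lt by lia; eauto.
      + rewrite nth_extend_lt by lia; eauto.
    - intros i j s s' H H' Hij; apply Hlr in H, H'.
      destruct H as [[t [H ->]]|[t [H1 [H2 ->]]]];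
      destruct H' as [[t' [H' ->]]|[t' [H1' [H2' ->]]]].
      + destruct (Hq3 i j t t' H H' Hij) as [k [Hk Hk']].
        exists k; rewrite !nth_extend_lt by lia; split; [lia|exact Hk'].
      + destruct (Hmix j i t' t H1' H2' H) as [k [Hk Hk']]; exists k; tauto.
      + apply Hmix; assumption.
      + destruct (Hp3 i j t t' H1 H1' Hij) as [k [Hk Hk']].
        exists k; rewrite !nth_extend_lt by lia; split; [lia|exact Hk']. }
  exists (exist _ (S N, lr) Hr); split; (split; [cbn; lia|]); cbn; intros i s Hi.
  - destruct (classic (exists t, In (i, t) lq)) as [[t Ht]|Hno].
    (* A common index is not new, as new ones lie above the support of [p]; so its two entries
       coincide. *)
    + assert (s = t).
      { destruct (Hroot i t Ht) as [H|H]; [eauto|].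
        exfalso; exact (Hirr i (H i s Hi)). }
      subst t; exists (extend n N 0 s); split; [apply Hlr; left; eauto|]; split.
      * intros; apply nth_extend_lt; lia.
      * intros; apply nth_extend_le; lia.
    + exists (extend n N M s); split.
      { apply Hlr; right; exists s; repeat split; auto.
        intros t' Ht'; apply Hno; exists t'; exact Ht'. }
      split.
      * intros; apply nth_extend_lt; lia.
      * intros; apply nth_extend_le; [lia|lia|intros ->; eauto].
  - exists (extend n N 0 s); split; [apply Hlr; left; eauto|]; split.
    * intros; apply nth_extend_lt; lia.
    * intros; apply nth_extend_le; lia.
Qed.

(** * Density of conditions with large indices *)

Lemma list_bounded (l : list (I * list nat)) :
  exists b, forall i s, In (i, s) l -> lt i b.
Proof.
  destruct (aleph1_bounded lt Haleph {x | In x l} (fun x => fst (proj1_sig x)))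
    as [b Hb].
  - destruct (functional_choice (fun (x : {x | In x l}) m => nth_error l m = Some (proj1_sig x)))
      as [f Hf].
    { intros [x Hx]; apply In_nth_error, Hx. }
    exists f; intros x y E.
    assert (E' : proj1_sig x = proj1_sig y).
    { pose proof (Hf x) as H1; pose proof (Hf y) as H2; congruence. }
    destruct x as [x Hx], y as [y Hy]; cbn in E'; subst y; f_equal.
    apply proof_irrelevance.
  - exists b; intros i s Hi; exact (Hb (exist _ (i, s) Hi)).
Qed.

(** Amalgamate [p] with a one-index condition of the same height whose index lies above [i] and the
    support of [p]. These dense sets make the generic support cofinal. *)
Lemma dense_unbounded (i : I) :
  dense cond_le (fun p => exists j s, In (j, s) (snd (proj1_sig p)) /\ lt i j).
Proof.
  intros p.
  destruct (list_bounded ((i, nil) :: snd (proj1_sig p))) as [b Hb].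
  (* By the default of [nth], the empty list stands for values 0. *)
  assert (Hq : wf (fst (proj1_sig p), (b, nil) :: nil)).
  { split; [|split]; cbn.
    - intros j s t [E|[]] [E'|[]]; congruence.
    - intros j s [E|[]] k _; injection E as <- <-; destruct k; cbn; lia.
    - intros j j' s t [E|[]] [E'|[]] H; congruence. }
  destruct (amalgamation p (exist _ _ Hq)) as [r [Hrp Hrq]].
  - reflexivity.
  - intros j t [E|[]]; injection E as <- <-; right; intros j s Hj.
    apply (Hb j s); right; exact Hj.
  - exists r; split; [exact Hrp|].
    destruct (proj2 Hrq b nil (or_introl eq_refl)) as [s [Hs _]].
    exists b, s; split; [exact Hs|]; apply (Hb i nil); left; reflexivity.
Qed.

(** * Countably many codes below a bound, and the ccc *)

Lemma countable_below (b : I) : countable (nat * list ({y | lt y b} * list nat)).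
Proof.
  apply countable_prod; [exact countable_nat|].
  apply countable_list, countable_prod; [apply Haleph|].
  apply countable_list, countable_nat.
Qed.

Definition erase {b : I} (x : nat * list ({y | lt y b} * list nat)) : precond :=
  (fst x, map (fun ys => (proj1_sig (fst ys), snd ys)) (snd x)).

Lemma erase_surj (b : I) (p : precond) :
  (forall i s, In (i, s) (snd p) -> lt i b) -> exists x, erase (b := b) x = p.
Proof.
  destruct p as [n l]; cbn; intros H.
  assert (Hl : exists l' : list ({y | lt y b} * list nat),
    map (fun ys => (proj1_sig (fst ys), snd ys)) l' = l).
  { induction l as [|[i s] l IH].
    - exists nil; reflexivity.
    - destruct IH as [l' Hl']; [intros; eapply H; right; eassumption|].
      exists ((exist _ i (H i s (or_introl eq_refl)), s) :: l'); cbn; congruence. }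
  destruct Hl as [l' Hl']; exists (n, l'); unfold erase; cbn; congruence.
Qed.

Lemma cond_ccc : ccc cond_le.
Proof.
  intros A HA; apply NNPP; intros HAunc.
  destruct Haleph as [[_ [Htrans Htot]] [_ _]].
  (* [above b c]: every trace below [b] of an element of [A] is realized in [A]
     by a condition with support below [c]. *)
  set (above := fun b c => lt b c /\ forall v q, A q ->
    (forall i s, In (i, s) v -> lt i b) ->
    (forall x, In x v -> In x (snd (proj1_sig q))) ->
    exists p, A p /\ fst (proj1_sig p) = fst (proj1_sig q) /\
      (forall x, In x v -> In x (snd (proj1_sig p))) /\
      (forall i s, In (i, s) (snd (proj1_sig p)) -> lt i c)).
  destruct (functional_choice above) as [next Hnext].
  { intros b.
    (* There are only countably many pairs of a height and a trace below [b], so the bounds chosen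
       for them have a common bound. *)
    destruct (functional_choice
      (fun (x : nat * list ({y | lt y b} * list nat)) c => lt b c /\
         ((exists q, A q /\ fst (proj1_sig q) = fst x /\
             forall z, In z (snd (erase x)) -> In z (snd (proj1_sig q))) ->
          exists p, A p /\ fst (proj1_sig p) = fst x /\
             (forall z, In z (snd (erase x)) -> In z (snd (proj1_sig p))) /\
             (forall i s, In (i, s) (snd (proj1_sig p)) -> lt i c))))
      as [top Htop].
    { intros x.
      destruct (classic (exists q, A q /\ fst (proj1_sig q) = fst x /\
             forall z, In z (snd (erase x)) -> In z (snd (proj1_sig q))))
        as [[q [Hq1 [Hq2 Hq3]]]|Hno].
      - destruct (list_bounded ((b, nil) :: snd (proj1_sig q))) as [c Hc].
        exists c; split; [apply (Hc b nil); left; reflexivity|]; intros _.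
        exists q; repeat split; auto; intros i s Hi; apply (Hc i s); right; exact Hi.
      - destruct (list_bounded ((b, nil) :: nil)) as [c Hc].
        exists c; split; [apply (Hc b nil); left; reflexivity|tauto]. }
    destruct (aleph1_bounded lt Haleph _ top (countable_below b)) as [c Hc].
    exists c; split.
    - apply (Htrans _ (top (0, nil))); [apply Htop|apply Hc].
    - intros v q Hq Hv Hvq.
      destruct (erase_surj b (fst (proj1_sig q), v) Hv) as [x Hx].
      assert (Hx1 : fst x = fst (proj1_sig q)) by exact (f_equal fst Hx).
      assert (Hx2 : snd (erase x) = v) by (rewrite Hx; reflexivity).
      destruct (proj2 (Htop x)) as [p [Hp1 [Hp2 [Hp3 Hp4]]]].
      { exists q; rewrite Hx2; auto. }
      rewrite Hx2 in Hp3; rewrite Hx1 in Hp2.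
      exists p; repeat split; auto; intros i s Hi; eapply Htrans; [eauto|apply Hc]. }
  destruct (list_bounded nil) as [b0 _].
  set (d := fix d m := match m with 0 => b0 | S m => next (d m) end).
  assert (Hd : forall m m' i, m <= m' -> lt i (d m) -> lt i (d m')).
  { intros m m' i Hm Hi; induction Hm as [|m' Hm IH]; [exact Hi|].
    apply (Htrans _ _ _ IH), Hnext. }
  destruct (aleph1_bounded lt Haleph nat d countable_nat) as [b Hb].
  (* If all supports lay below [b], the countable codes would exhaust [A]. *)
  assert (Hq : exists q, A q /\
    exists i s, In (i, s) (snd (proj1_sig q)) /\ ~ lt i b).
  { apply NNPP; intros Hno; apply HAunc.
    destruct (functional_choice (fun (q : {q | A q}) x =>
      erase (b := b) x = proj1_sig (proj1_sig q))) as [f Hf].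
    { intros [q Aq]; apply erase_surj; intros i s Hi; apply NNPP; intros Hib.
      apply Hno; exists q; eauto. }
    apply (countable_of_injective f); [|apply countable_below].
    intros q q' E; pose proof (Hf q) as H1; pose proof (Hf q') as H2.
    assert (E' : proj1_sig q = proj1_sig q') by (apply cond_eq; congruence).
    destruct q as [q Aq], q' as [q' Aq']; cbn in E'; subst q'; f_equal.
    apply proof_irrelevance. }
  destruct Hq as [q [Aq [i0 [s0 [Hi0 Hi0b]]]]].
  (* [v] is the trace of [q] below the supremum of the [d m]; being finite, it lies below a single
     [d m]. *)
  destruct (sublist_exists (fun is => exists m, lt (fst is) (d m)) (snd (proj1_sig q)))
    as [v Hv].
  destruct (eventually_forall_list (fun is m => lt (fst is) (d m)) v) as [m Hm].
  { intros is His; apply Hv in His as [_ [m Hm]]; exists m; eauto. }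
  destruct (proj2 (Hnext (d m)) v q Aq) as [p [Ap [Hp1 [Hp2 Hp3]]]].
  { intros i s Hi; apply (Hm (i, s) Hi m (le_n m)). }
  { intros x Hx; apply Hv, Hx. }
  apply (HA p q Ap Aq).
  (* The support of [p] lies below [b], that of [q] does not. *)
  - intros ->; apply Hi0b; eapply Htrans; [exact (Hp3 _ _ Hi0)|exact (Hb (S m))].
  - apply amalgamation; [exact Hp1|]; intros j t Hj.
    destruct (classic (exists m', lt j (d m'))) as [Hjm|Hjm].
    + left; apply Hp2, Hv; auto.
    (* An index outside the trace is below no [d m'], hence at least [d (S m)] and above the support
       of [p]. *)
    + right; intros i s Hi; pose proof (Hp3 i s Hi : lt i (d (S m))) as Hi'.
      destruct (Htot j (d (S m))) as [H|[H|H]].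
      * exfalso; apply Hjm; exists (S m); exact H.
      * rewrite H; exact Hi'.
      * exact (Htrans _ _ _ Hi' H).
Qed.

(** * The generic family obtained from MA *)

Lemma MA_separated_family : MA_aleph1 ->
  exists (U : I -> Prop) (g : I -> baire),
    (forall i, exists j, U j /\ lt i j) /\
    (forall i k, g i k <= flo i k) /\
    (forall i j, U i -> U j -> le_star (g i) (flo j)) /\
    (forall i j, U i -> U j -> i <> j ->
       exists k, flo j k < g i k \/ flo i k < g j k).
Proof.
  intros MA.
  assert (Hnil : wf (0, nil)) by (repeat split; cbn; tauto).
  destruct (MA cond cond_le (inhabits (exist _ _ Hnil)) cond_le_refl cond_le_trans
    cond_ccc I lt Haleph _ dense_unbounded) as [G [Gdir GD]].
  set (val := fun i k v => exists p s, G p /\ In (i, s) (snd (proj1_sig p)) /\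
                k < fst (proj1_sig p) /\ nth k s 0 = v).
  (* A common extension of [p] and the condition giving [v] has only one entry for [i], which
     inherits from both. *)
  assert (Hval : forall i k v p s, val i k v -> G p ->
    In (i, s) (snd (proj1_sig p)) -> exists r s', G r /\ cond_le r p /\
      k < fst (proj1_sig r) /\ In (i, s') (snd (proj1_sig r)) /\ nth k s' 0 = v /\
      (forall k', k' < fst (proj1_sig p) -> nth k' s' 0 = nth k' s 0) /\
      (forall k', fst (proj1_sig p) <= k' -> k' < fst (proj1_sig r) ->
         forall j t, In (j, t) (snd (proj1_sig p)) -> nth k' s' 0 <= flo j k')).
  { intros i k v p s [q [t [Gq [Ht [Hk <-]]]]] Gp Hs.
    destruct (Gdir p q Gp Gq) as [r [Gr [Hrp Hrq]]].
    destruct (proj2 Hrp i s Hs) as [s' [Hs' [Hs1 Hs2]]].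
    destruct (proj2 Hrq i t Ht) as [t' [Ht' [Ht1 Ht2]]].
    assert (s' = t') by exact (proj1 (proj2_sig r) i s' t' Hs' Ht'); subst t'.
    exists r, s'; pose proof (proj1 Hrq); repeat split; auto; try lia; apply Hrp. }
  assert (Hfun : forall i k p s v, G p -> In (i, s) (snd (proj1_sig p)) ->
    k < fst (proj1_sig p) -> val i k v -> v = nth k s 0).
  { intros i k p s v Gp Hs Hk Hv.
    destruct (Hval i k v p s Hv Gp Hs) as [r [s' [_ [_ [_ [_ [<- [H _]]]]]]]]; auto. }
  (* Levels that [G] leaves undecided get 0, which respects all upper bounds. *)
  destruct (functional_choice (fun ik v =>
    val (fst ik) (snd ik) v \/ (v = 0 /\ forall v', ~ val (fst ik) (snd ik) v')))
    as [g Hg].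
  { intros [i k]; cbn; destruct (classic (exists v, val i k v)) as [[v Hv]|Hno].
    - exists v; auto.
    - exists 0; right; split; [reflexivity|]; intros v Hv; apply Hno; eauto. }
  assert (Hgv : forall i k p s, G p -> In (i, s) (snd (proj1_sig p)) ->
    k < fst (proj1_sig p) -> g (i, k) = nth k s 0).
  { intros i k p s Gp Hs Hk; destruct (Hg (i, k)) as [H|[_ H]]; cbn in H.
    - eapply Hfun; eassumption.
    - exfalso; apply (H (nth k s 0)); exists p, s; auto. }
  set (U := fun i => exists p s, G p /\ In (i, s) (snd (proj1_sig p))).
  assert (HU : forall i j, U i -> U j -> exists p s t, G p /\
    In (i, s) (snd (proj1_sig p)) /\ In (j, t) (snd (proj1_sig p))).
  { intros i j [p [s [Gp Hs]]] [q [t [Gq Ht]]].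
    destruct (Gdir p q Gp Gq) as [r [Gr [Hrp Hrq]]].
    destruct (proj2 Hrp i s Hs) as [s' [Hs' _]].
    destruct (proj2 Hrq j t Ht) as [t' [Ht' _]].
    exists r, s', t'; auto. }
  exists U, (fun i k => g (i, k)); split; [|split; [|split]].
  - intros i; destruct (GD i) as [p [Gp [j [s [Hj Hij]]]]].
    exists j; split; [exists p, s; auto|exact Hij].
  - intros i k; destruct (Hg (i, k)) as [H|[-> _]]; [|lia]; cbn in H.
    destruct H as [p [s [Gp [Hs [Hk <-]]]]]; exact (proj1 (proj2 (proj2_sig p)) i s Hs k Hk).
  - intros i j Ui Uj; destruct (HU i j Ui Uj) as [p [s [t [Gp [Hs Ht]]]]].
    (* Beyond the height of [p], its promise for [i] and [j] gives the bound. *)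
    exists (fst (proj1_sig p)); intros k Hk.
    destruct (Hg (i, k)) as [H|[-> _]]; [|lia]; cbn in H.
    destruct (Hval i k _ p s H Gp Hs) as [r [s' [_ [_ [Hkr [_ [<- [_ Hr]]]]]]]].
    eapply Hr; eassumption.
  - intros i j Ui Uj Hij; destruct (HU i j Ui Uj) as [p [s [t [Gp [Hs Ht]]]]].
    destruct (proj2 (proj2 (proj2_sig p)) i j s t Hs Ht Hij) as [k [Hk Hk']].
    exists k; rewrite (Hgv i k p s Gp Hs Hk), (Hgv j k p t Gp Ht Hk); exact Hk'.
Qed.

End Forcing.

(** * No interpolating function, hence no peculiar cut *)

Lemma separated_family_not_split {I : Type} (flo g : I -> baire) (U : I -> Prop) :
  ~ countable {i | U i} ->
  (forall i k, g i k <= flo i k) ->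
  (forall i j, U i -> U j -> i <> j ->
     exists k, flo j k < g i k \/ flo i k < g j k) ->
  forall h, ~ forall i, U i -> le_star (g i) h /\ le_star h (flo i).
Proof.
  intros Hunc Hle Hsep h Hh; apply Hunc.
  destruct (functional_choice (fun (i : {i | U i}) N =>
    forall k, N <= k -> g (proj1_sig i) k <= h k <= flo (proj1_sig i) k)) as [N HN].
  { intros [i Ui]; destruct (Hh i Ui) as [[N HN] [M HM]].
    exists (max N M); intros k Hk; split; [apply HN|apply HM]; lia. }
  apply (countable_of_injective
    (fun i => (N i, map (flo (proj1_sig i)) (seq 0 (N i))))).
  - intros i j E; injection E as EN E; rewrite <- EN in E.
    assert (Hlow : forall k, k < N i -> flo (proj1_sig i) k = flo (proj1_sig j) k).
    { intros k Hk; apply (ext_in_map E), in_seq; lia. }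
    assert (Eij : proj1_sig i = proj1_sig j).
    { apply NNPP; intros Hij.
      destruct (Hsep _ _ (proj2_sig i) (proj2_sig j) Hij) as [k Hk].
      pose proof (Hle (proj1_sig i) k); pose proof (Hle (proj1_sig j) k).
      (* From the common threshold on, [h] lies above both [g] values and below both [flo] values;
         before it, the two [flo] values agree. *)
      destruct (le_lt_dec (N i) k) as [Hk'|Hk'].
      - pose proof (HN i k Hk'); pose proof (HN j k ltac:(lia)); lia.
      - pose proof (Hlow k Hk'); lia. }
    destruct i as [i Ui], j as [j Uj]; cbn in Eij; subst j; f_equal.
    apply proof_irrelevance.
  - apply countable_prod; [|apply countable_list]; exact countable_nat.
Qed.

Theorem theorem3p3 :
  forall (K : Type) (ltK : K -> K -> Prop),
    is_regular_cardinal K ltK ->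
    above_aleph1 K ->
    MA_aleph1 ->
    forall (I : Type) (ltI : I -> I -> Prop),
      is_aleph1 I ltI ->
      ~ exists (flo : I -> baire) (fup : K -> baire), peculiar_cut ltI ltK flo fup.
Proof.
  intros K ltK HK Habove MA I ltI HI [flo [fup [Hdec [Hinc [Hlt [Hdown _]]]]]].
  destruct (MA_separated_family flo ltI HI Hdec MA) as [U [g [HU [Hle [Hstar Hsep]]]]].
  assert (Hunc : ~ countable {i | U i}).
  { intros Hc.
    destruct (aleph1_bounded ltI HI _ (@proj1_sig _ U) Hc) as [b Hb].
    destruct (HU b) as [j [Uj Hj]].
    apply (strict_well_order_irrefl ltI (proj1 HI) b).
    apply (proj1 (proj2 (proj1 HI)) _ j _ Hj), (Hb (exist _ j Uj)). }
  destruct (functional_choice (fun i a => U i -> le_star (g i) (fup a))) as [a Ha].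
  { intros i; destruct (classic (U i)) as [Ui|Ui].
    - destruct (Hdown (g i)) as [a Ha]; [|exists a; auto].
      (* [Hstar] needs an index in [U]: take one above [j] and use that [flo] decreases. *)
      intros j; destruct (HU j) as [j' [Uj' Hj']].
      destruct (Hstar i j' Ui Uj') as [N HN], (Hdec j j' Hj') as [M HM].
      exists (max N M); intros k Hk.
      pose proof (HN k ltac:(lia)); pose proof (HM k ltac:(lia)); lia.
    (* Outside [U] any element of [K] will do. *)
    - destruct (proj1 (proj2 HK)) as [e _]; exists (e 0); contradiction. }
  destruct (regular_bounded ltK ltI HK Habove HI a) as [b Hb].
  apply (separated_family_not_split flo g U Hunc Hle Hsep (fup b)); intros i Ui; split.
  - destruct (Ha i Ui) as [N HN], (Hinc _ _ (Hb i)) as [M HM].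
    exists (max N M); intros k Hk.
    pose proof (HN k ltac:(lia)); pose proof (HM k ltac:(lia)); lia.
  - destruct (Hlt i b) as [N HN]; exists N; intros k Hk; apply Nat.lt_le_incl, HN, Hk.
Qed.
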